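(* Let $E$ be a symmetric operator defined on a dense domain $\mathcal D$ of a Hilbert space $\mathcal H$. Let $\mathbf d=\{d_i\}_{i\in\mathbb N}$ and $\boldsymbol\lambda=\{\lambda_i\}_{i\in\mathbb N}$ be nondecreasing unbounded real sequences such that \[ \delta_k:=\sum_{i=1}^k(d_i-\lambda_i)\ge0\qquad\text{for all }k\in\mathbb N. \] Assume there exists $M\ge0$ such that $\delta_k\ge\alpha:=\liminf_{i\to\infty}\delta_i$ for all $k\ge M$. If $\{f_i\}_{i\in\mathbb N}\subset\mathcal D$ is an orthonormal sequence with $\langle Ef_i,f_i\rangle=\lambda_i$ for all $i$, then there exists an orthonormal sequence $\{e_i\}_{i\in\mathbb N}$, each element of which lies in the (algebraic) linear span of $\{f_i\}_{i\in\mathbb N}$, such that $\overline{\operatorname{span}}\{e_i\}=\overline{\operatorname{span}}\{f_i\}$ and $\langle Ee_i,e_i\rangle=d_i$ for all $i\in\mathbb N$.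
   Context: $E$ symmetric means $\langle Ef,g\rangle=\langle f,Eg\rangle$ for all $f,g\in\mathcal D$. $\overline{\operatorname{span}}$ is the closed linear span. *)

(* Defs.v *)
From HB Require Import structures.
From mathcomp Require Import all_boot all_order all_algebra.
From mathcomp Require Import all_classical all_reals.
From mathcomp Require Import constructive_ereal ereal sequences.
From mathcomp Require Import complex.
Set Implicit Arguments. Unset Strict Implicit. Unset Printing Implicit Defensive.
Import Order.TTheory GRing.Theory Num.Theory.
Local Open Scope ring_scope.
Local Open Scope complex_scope.

Section Hilbert.
Variables (R : realType) (H : lmodType R[i]) (ip : H -> H -> R[i]).

Definition nrm2 (x : H) : R := complex.Re (ip x x).

Definition is_inner_product : Prop :=
  [/\ forall (a : R[i]) (x y z : H), ip (a *: x + y) z = a * ip x z + ip y z,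
      forall x y : H, ip y x = (ip x y)^*,
      forall x : H, 0 <= ip x x &
      forall x : H, ip x x = 0 -> x = 0].

Definition is_complete : Prop :=
  forall u : nat -> H,
    (forall eps : R, 0 < eps -> exists N, forall m n, (N <= m)%N -> (N <= n)%N ->
        nrm2 (u m - u n) < eps ^+ 2) ->
    exists l : H, forall eps : R, 0 < eps -> exists N, forall n, (N <= n)%N ->
        nrm2 (u n - l) < eps ^+ 2.

Definition is_hilbert : Prop := is_inner_product /\ is_complete.

Definition hclosure (A : set H) : set H :=
  [set x | forall eps : R, 0 < eps -> exists y, A y /\ nrm2 (x - y) < eps ^+ 2].

Definition hdense (A : set H) : Prop := hclosure A = setT.

Definition aspan (g : nat -> H) : set H :=
  [set x | exists (n : nat) (c : nat -> R[i]), x = \sum_(j < n) c j *: g j].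

Definition cspan (g : nat -> H) : set H := hclosure (aspan g).

Definition horthonormal (g : nat -> H) : Prop :=
  forall i j : nat, ip (g i) (g j) = (i == j)%:R.

Definition hsubspace (D : set H) : Prop :=
  D 0 /\ forall (a : R[i]) x y, D x -> D y -> D (a *: x + y).

(* E : D -> H is a linear operator (values of E outside D are irrelevant) *)
Definition hlinear_on (D : set H) (E : H -> H) : Prop :=
  forall (a : R[i]) x y, D x -> D y -> E (a *: x + y) = a *: E x + E y.

Definition hsymmetric_on (D : set H) (E : H -> H) : Prop :=
  forall f g, D f -> D g -> ip (E f) g = ip f (E g).

End Hilbert.

Definition unbounded_seq (R : realType) (u : nat -> R) : Prop :=
  forall M : R, exists i, M < u i.

(* delta d l k = \sum_{i=1}^{k+1} (d_i - lambda_i) in the paper's 1-based indexing *)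
Definition delta (R : realType) (d l : nat -> R) (k : nat) : R :=
  \sum_(i < k.+1) (d i - l i).

(* Main.v *)
(* Two orthonormal vectors u, v with diagonal entries a <= b can be rotated in
   their span, with a phase killing the contribution of <Eu, v>, so that the
   entries become c and a + b - c for any prescribed c in [a, b].  Passing from
   [l] to [d] is done through an intermediate diagonal
   mu i = d i + C i - C i.+1, where the carry C is bounded, dominated by the
   partial sums of d - l, and equal to them infinitely often.  Between two
   consecutive equality indices mu is sorted and majorized by l, so finitely
   many rotations turn l into mu there, and the algebraic span is unchanged.
   From mu to d one rotates successively the k-th and (k+1)-st vectors; the
   left-over vector r_k has entry d k - C k.+1, and the component of a fixed
   vector along r_k is multiplied at each step by a factor of square
   C k.+1 / (C k.+1 + mu k.+1 - d k).  As C is bounded and d unbounded, the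
   product of these factors tends to 0, so no vector is lost in the closure. *)
Require Import Defs.
From HB Require Import structures.
From mathcomp Require Import all_boot all_order all_algebra.
From mathcomp Require Import all_classical all_reals.
From mathcomp Require Import constructive_ereal ereal sequences.
From mathcomp Require Import complex.
From mathcomp Require Import zify ring lra.
Import Order.TTheory GRing.Theory Num.Theory.
Local Open Scope ring_scope.
Local Open Scope complex_scope.
Set Implicit Arguments. Unset Strict Implicit. Unset Printing Implicit Defensive.

(** The step need only work from states satisfying the invariant [P]; elsewhere the chosen successor
    is the state itself. [Q] records how consecutive stages of a construction are related. *)
Lemma dependent_choice_nat (T : Type) (P : nat -> T -> Prop)
    (Q : nat -> T -> T -> Prop) (x0 : T) :
  P 0%N x0 -> (forall k x, P k x -> exists y, P k.+1 y /\ Q k x y) ->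
  exists s : nat -> T,
    [/\ s 0%N = x0, forall k, P k (s k) & forall k, Q k (s k) (s k.+1)].
Proof.
move=> P0 step.
have [h hP] : {h : nat -> T -> T & forall k x, P k x ->
    P k.+1 (h k x) /\ Q k x (h k x)}.
  have /choice[h hP] : forall kx : nat * T, exists y,
      P kx.1 kx.2 -> P kx.1.+1 y /\ Q kx.1 kx.2 y.
    move=> [k x] /=; have [/step[y Py]|nP] := pselect (P k x); first by exists y.
    by exists x.
  by exists (fun k x => h (k, x)) => k x /(hP (k, x)).
pose s := fix s k := if k is k'.+1 then h k' (s k') else x0.
have sP k : P k (s k) by elim: k => //= k /hP[].
by exists s; split => // k; have [] := hP _ _ (sP k).
Qed.

(** * Real sequences: recurrence, running minima and the carry *)

Section RealSequences.
Variable R : realType.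
Implicit Types (u d l : nat -> R).

Lemma le_limn_einf (u : nat -> \bar R) (x : \bar R) (K : nat) :
  (forall k, (K <= k)%N -> (x <= u k)%E) -> (x <= limn_einf u)%E.
Proof.
move=> xu; rewrite limn_einf_lim (cvg_lim _ (@cvg_einfs_sup _ u))//.
apply: le_trans (ereal_sup_ubound _); last by exists K.
by apply: le_ereal_inf_tmp => _ [k /= Kk <-]; exact: xu.
Qed.

(* [psum d l k.+1] is [delta d l k]. *)
Definition psum d l (k : nat) : R := \sum_(i < k) (d i - l i).

(** It forces every term to be at least the lower limit, without mentioning a limit, and it makes
    running minima recur. *)
Definition recurrently_below u :=
  forall K N, exists k, (N <= k)%N /\ u k <= u K.

(* If the lower limit is attained infinitely often, take any late index; if it
   is eventually exceeded strictly, the indices past that point do. *)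
Lemma liminf_recurrently_below u :
  (exists M : nat, forall k : nat, (M <= k)%N ->
     (limn_einf (fun i => (u i)%:E) <= (u k)%:E)%E) ->
  exists M, recurrently_below (fun k => u (M + k)%N).
Proof.
set a := limn_einf _ => -[M aM].
have [io|] := pselect (forall N, exists k, (N <= k)%N /\ ((u k)%:E <= a)%E).
  exists M => K N; have [k [Nk ka]] := io (M + N)%N.
  exists (k - M)%N; split; first lia.
  rewrite (_ : (M + (k - M) = k)%N); last lia.
  by rewrite -lee_fin (le_trans ka)// aM// leq_addr.
move=> /existsNP[M' M'P]; exists M' => K N.
apply: contrapT => nk; apply: M'P; exists (M' + K)%N; split; first exact: leq_addr.
apply: (@le_limn_einf _ _ (M' + N)) => k Nk; rewrite lee_fin leNgt; apply/negP => uk.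
apply: nk; exists (k - M')%N; split; first lia.
by rewrite (_ : (M' + (k - M') = k)%N) 1?ltW//; lia.
Qed.

Fixpoint running_min u (k : nat) : R :=
  if k is k'.+1 then Order.min (running_min u k') (u k) else u 0%N.

Lemma running_min_le u k i : (i <= k)%N -> running_min u k <= u i.
Proof.
elim: k => [|k IH] /=; first by rewrite leqn0 => /eqP ->.
rewrite leq_eqVlt => /orP[/eqP ->|]; rewrite ge_min ?lexx ?orbT//.
by rewrite ltnS => /IH ->.
Qed.

Lemma running_min_attained u k : exists i, running_min u k = u i.
Proof.
elim: k => [|k [i ui]] /=; first by exists 0%N.
by rewrite minElt; case: ifP => _; [exists i | exists k.+1].
Qed.

(** The running minimum at [N] is matched or undercut at some index from [N] on; before the first
    such index it has not moved, so the term there attains it. *)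
Lemma running_min_io u : recurrently_below u ->
  forall N, exists k, (N <= k)%N /\ running_min u k = u k.
Proof.
move=> rb N; have [i mi] := running_min_attained u N.
have [k0 [Nk ki]] := rb i N.
have ex : exists k, (N <= k)%N && (u k <= running_min u N).
  by exists k0; rewrite Nk mi.
case: (ex_minnP ex) => k /andP[{}Nk uk] kmin; exists k; split=> //.
have cst : forall j, (N + j < k)%N -> running_min u (N + j) = running_min u N.
  elim=> [|j IH]; first by rewrite addn0.
  rewrite addnS => jk /=; rewrite IH; last lia.
  apply/min_idPl; rewrite leNgt; apply/negP => lt.
  by have := kmin (N + j).+1; rewrite (ltW lt) => h; lia.
apply/eqP; rewrite eq_le running_min_le//=.
case: k Nk uk {kmin} cst => [|k] Nk uk cst //.
have [kN|kN] := eqVneq k.+1 N; first by rewrite kN in uk *.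
rewrite /= le_min lexx andbT (_ : k = (N + (k - N))%N); last lia.
rewrite cst; last lia.
by rewrite -(_ : k = (N + (k - N))%N)//; lia.
Qed.

(* The carry [C] measures how far the intermediate diagonal
   [d i + C i - C i.+1] lags behind [d].  Up to a late record minimum [n] of
   the partial sums it comes from inserting [v := d n.-1 - psum d l n] at its
   sorted place among the [d i]; from [n] on it is the running minimum. *)
Lemma carry_exists d l :
  nondecreasing_seq d -> unbounded_seq d -> (forall k, 0 <= psum d l k) ->
  (exists M, recurrently_below (fun k => psum d l (M + k))) ->
  exists (C : nat -> R) (B : R),
    [/\ C 0%N = 0, forall k, 0 <= C k <= psum d l k, forall k, C k <= B,
        forall N, exists k, (N <= k)%N /\ C k = psum d l k &
        (forall k, d k <= d k.+1 + C k.+1 - C k.+2) /\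
        (forall k, C k.+1 < psum d l k.+1 -> C k <= C k.+1)].
Proof.
set D := psum d l => dnd dub D0 [M rb].
(* [N0] is late enough that [v], built from an entry of [d] at or past it, is at least [d M]; the
   entries up to [M] then stay in place. *)
have [N0 N0P] := dub (d M + D M).
have [j [N0j jrec]] := running_min_io rb (N0 + M).+2.
pose n := (M + j)%N; pose v := d n.-1 - D n.
have nrec k : (M <= k <= n)%N -> D n <= D k.
  move=> Mkn; have := @running_min_le (fun k => D (M + k)%N) j (k - M).
  rewrite jrec /= (_ : (M + (k - M) = k)%N); last lia.
  by apply; rewrite /n in Mkn; lia.
have vM : d M <= v.
  have dn : d N0 <= d n.-1 by apply: dnd; rewrite /n; lia.
  have : D n <= D M by apply: nrec; rewrite /n; lia.
  by rewrite /v; lra.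
have n0 : (0 < n)%N by rewrite /n; lia.
have rbn : recurrently_below (fun k => D (n + k)%N).
  move=> K N; have [k [Nk kK]] := rb (j + K)%N (j + N)%N.
  exists (k - j)%N; split; first lia.
  rewrite /n (_ : (M + j + (k - j) = M + k)%N); last lia.
  by rewrite -addnA.
pose rm := running_min (fun k => D (n + k)%N).
(* For [k < n] this makes [d k + C k - C k.+1] equal to [d k] while [d k <= v], to [v] at the first
   [d k] above [v], and to [d k.-1] afterwards. Both formulas give [D n] at [n]. *)
pose C k := if (k <= n)%N then (if k is k'.+1 then Order.max (d k' - v) 0 else 0)
            else rm (k - n)%N.
have dmon i k : (i <= k)%N -> d i <= d k by move=> ik; exact: dnd.
have Clow k : (k < n)%N -> C k.+1 = Order.max (d k - v) 0 by rewrite /C => ->.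
have Cn : C n = D n.
  rewrite -{1}(prednK n0) Clow ?prednK// (_ : d n.-1 - v = D n).
    by apply/max_idPl; exact: D0.
  by rewrite /v; lra.
have Cge k : C (n + k)%N = rm k.
  case: k => [|k]; first by rewrite addn0 Cn /rm /= addn0.
  rewrite /C (_ : (n + k.+1 <= n)%N = false) ?addKn//; lia.
have CS k : (n <= k)%N -> C k.+1 = Order.min (C k) (D k.+1).
  move=> nk; rewrite (_ : k = (n + (k - n))%N); last lia.
  by rewrite -addnS !Cge.
have Cle k : (n <= k)%N -> C k.+1 <= C k.
  by move=> /CS ->; rewrite ge_min lexx.
have C0 k : 0 <= C k.
  rewrite /C; case: ifP => _; first by case: k => // k; rewrite le_max lexx orbT.
  by rewrite /rm; have [i ->] := running_min_attained (fun k => D (n + k)%N) (k - n); exact: D0.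
have CD k : C k <= D k.
  have [kn|nk] := leqP k n; last first.
    rewrite (_ : k = (n + (k - n))%N); last lia.
    by rewrite Cge; exact: (@running_min_le (fun k => D (n + k)%N)).
  case: k kn => [|k] kn; first by rewrite /C /=; exact: D0.
  rewrite Clow// ge_max D0 andbT.
  (* Up to [M] the carry vanishes, as [d k <= d M <= v]; after it, [d k - v <= D n] and the record
     property gives [D n <= D k.+1]. *)
  have [kM|Mk] := leqP k M; first by have := dmon _ _ kM; have := D0 k.+1; lra.
  have h : D n <= D k.+1 by apply: nrec; lia.
  have : d k <= d n.-1 by apply: dmon; lia.
  by rewrite /v; lra.
exists C, (D n); split.
- by rewrite /C.
- by move=> k; rewrite C0 CD.
- move=> k; have [kn|nk] := leqP k n; last first.
    rewrite (_ : k = (n + (k - n))%N); last lia.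
    rewrite Cge; have := @running_min_le (fun k => D (n + k)%N) (k - n) 0%N.
    by rewrite addn0; apply.
  case: k kn => [|k] kn; first by rewrite {1}/C.
  rewrite Clow// ge_max D0 andbT.
  have : d k <= d n.-1 by apply: dmon; lia.
  by rewrite /v; lra.
- move=> N; have [k [Nk rk]] := running_min_io rbn N.
  by exists (n + k)%N; split; [lia | rewrite Cge].
split=> k.
  have dk : d k <= d k.+1 by apply: dmon.
  have [kn|nk] := ltnP k.+1 n; last by have := Cle _ nk; lra.
  by rewrite !Clow//; [case: (leP (d k - v) 0); case: (leP (d k.+1 - v) 0); lra | lia].
(* Past [n] the carry decreases only by dropping onto the partial sum, so a strict inequality means
   that it did not move. *)
have [kn|nk] := leqP k.+1 n; last first.
  by rewrite CS// minElt; case: ifP; rewrite ?lexx ?ltxx.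
rewrite Clow//; case: k kn => [|k] kn; first by rewrite {1}/C le_max lexx orbT.
rewrite Clow; last lia.
have dk : d k <= d k.+1 by apply: dmon.
by move=> _; rewrite ge_max !le_max lexx orbT andbT; apply/orP; left; lra.
Qed.

End RealSequences.

(** * Complex arithmetic and the coefficients of a rotation *)

Section ComplexRing.
Variable R : realType.
Implicit Types (x y : R[i]) (r s : R).

Lemma conjcM x y : conjc (x * y) = conjc x * conjc y.
Proof. exact: rmorphM. Qed.

Lemma conjcD x y : conjc (x + y) = conjc x + conjc y.
Proof. exact: rmorphD. Qed.

Lemma conjcN x : conjc (- x) = - conjc x.
Proof. exact: rmorphN. Qed.

Lemma real_complexM r s : (r * s)%:C = r%:C * s%:C.
Proof. exact: rmorphM. Qed.

Lemma real_complexD r s : (r + s)%:C = r%:C + s%:C.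
Proof. exact: rmorphD. Qed.

End ComplexRing.

(** [p] and [q] are a cosine and a sine with phase; the squared sine [s] is the position of [c] on
    the segment from [a] to [b]. The last equation asks that [conjc q * z] be purely imaginary,
    which a suitable phase achieves. *)
Lemma rotation_coef (R : realType) (a b c : R) (z : R[i]) : a <= c <= b ->
  exists (p s : R) (q : R[i]),
    [/\ 0 <= s, p ^+ 2 + s = 1, s * (b - a) = c - a, q * conjc q = s%:C &
        conjc q * z + q * conjc z = 0].
Proof.
move=> /andP[ac cb].
have [s [s0 s1 sE]] : exists s, [/\ 0 <= s, s <= 1 & s * (b - a) = c - a].
  have [ba|ba] := eqVneq b a; first by exists 0; split=> //; lra.
  have ba0 : 0 < b - a.
    by rewrite subr_gt0 lt_neqAle eq_sym ba (le_trans ac).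
  exists ((c - a) / (b - a)); split.
  - by rewrite divr_ge0//; lra.
  - by rewrite ler_pdivrMr//; lra.
  - by rewrite divfK// gt_eqF.
have [w [ww wz]] : exists w : R[i], w * conjc w = 1 /\ conjc w * z + w * conjc z = 0.
  case: z => x y; have [xy0|xy0] := eqVneq (x ^+ 2 + y ^+ 2) 0.
    exists 1; split; first by rewrite conjc1 mulr1.
    have x0 : x = 0 by have := sqr_ge0 x; have := sqr_ge0 y; nra.
    have y0 : y = 0 by have := sqr_ge0 x; have := sqr_ge0 y; nra.
    by rewrite x0 y0; apply/eqP; rewrite eq_complex /=; apply/andP; split; apply/eqP; ring.
  pose n := Num.sqrt (x ^+ 2 + y ^+ 2).
  have nn : n ^+ 2 = x ^+ 2 + y ^+ 2 by rewrite sqr_sqrtr// addr_ge0// sqr_ge0.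
  have n0 : n != 0 by apply: contraNneq xy0 => n0; rewrite -nn n0 expr0n.
  (* This is the imaginary unit times [z / |z|], a quarter turn from the phase of [z]. *)
  exists ((- y / n) +i* (x / n)); split; apply/eqP; rewrite eq_complex /=;
    apply/andP; split; apply/eqP.
  - transitivity ((x ^+ 2 + y ^+ 2) / n ^+ 2); first by field.
    by rewrite -nn divff// expf_neq0.
  - by field.
  - by field.
  - by field.
exists (Num.sqrt (1 - s)), s, ((Num.sqrt s)%:C * w); split=> //.
- by rewrite sqr_sqrtr ?subrK// subr_ge0.
- rewrite conjcM conjc_real mulrACA ww mulr1 -real_complexM.
  by rewrite -expr2 sqr_sqrtr.
- by rewrite conjcM conjc_real -!mulrA -mulrDr wz mulr0.
Qed.

(** * Spans of initial segments and stabilising families *)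

Section FiniteSpan.
Variables (R : realType) (H : lmodType R[i]).
Implicit Types (g : nat -> H) (x y : H).

Definition fspan (n : nat) g : set H :=
  [set x | exists c : nat -> R[i], x = \sum_(j < n) c j *: g j].

(** A rotation mixes two vectors, so short initial spans may change; those long enough to contain
    every rotated index do not. *)
Definition same_spans_from (n : nat) g g' :=
  forall N, (n <= N)%N -> fspan N g = fspan N g'.

Lemma fspan_comb n g (a : R[i]) x y :
  fspan n g x -> fspan n g y -> fspan n g (a *: x + y).
Proof.
move=> [c ->] [c' ->]; exists (fun j => a * c j + c' j).
rewrite scaler_sumr -big_split /=; apply: eq_bigr => j _.
by rewrite scalerDl scalerA.
Qed.

Lemma fspan0 n g : fspan n g 0.
Proof. by exists (fun=> 0); rewrite big1// => j _; rewrite scale0r. Qed.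

Lemma fspan_comb2 n g (a b : R[i]) x y :
  fspan n g x -> fspan n g y -> fspan n g (a *: x + b *: y).
Proof.
by move=> gx gy; apply: fspan_comb => //; rewrite -[_ *: _]addr0;
  apply: fspan_comb => //; exact: fspan0.
Qed.

Lemma fspan_gen n g j : (j < n)%N -> fspan n g (g j).
Proof.
move=> jn; exists (fun k => (k == j)%:R).
rewrite (bigD1 (Ordinal jn))//= eqxx scale1r big1 ?addr0// => k.
by rewrite -val_eqE /= => /negbTE ->; rewrite scale0r.
Qed.

Lemma fspan_sub n n' g g' : (forall j, (j < n)%N -> fspan n' g' (g j)) ->
  (fspan n g `<=` fspan n' g')%classic.
Proof.
move=> gg' x [c ->]; apply: (@big_ind _ (fspan n' g')) => [|y z Hy Hz|j _].
- exact: fspan0.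
- by rewrite -[y]scale1r; exact: fspan_comb.
- by rewrite -[_ *: _]addr0; apply: fspan_comb; [exact: gg' | exact: fspan0].
Qed.

Lemma fspan_widen n n' g : (n <= n')%N -> (fspan n g `<=` fspan n' g)%classic.
Proof.
move=> nn'; apply: fspan_sub => j jn; apply: fspan_gen; exact: leq_trans nn'.
Qed.

Lemma eq_fspan n g g' : (forall j, (j < n)%N -> g j = g' j) -> fspan n g = fspan n g'.
Proof.
move=> gg'; apply/seteqP; split; apply: fspan_sub => j jn.
  by rewrite gg'//; exact: fspan_gen.
by rewrite -gg'//; exact: fspan_gen.
Qed.

Lemma aspan_sub g g' : (forall i, aspan g (g' i)) -> (aspan g' `<=` aspan g)%classic.
Proof.
move=> gg' x [n [c ->]]; apply: (@big_ind _ (aspan g)) => [|y z [p yp] [q zq]|j _].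
- by exists 0%N; exact: fspan0.
- exists (maxn p q); rewrite -[y]scale1r.
  by apply: fspan_comb; [exact: fspan_widen (leq_maxl _ _) _ yp |
    exact: fspan_widen (leq_maxr _ _) _ zq].
- have [p gp] := gg' j; exists p; rewrite -[_ *: _]addr0.
  by apply: fspan_comb => //; exact: fspan0.
Qed.

Lemma same_spans_trans n n' g1 g2 g3 : (n <= n')%N ->
  same_spans_from n g1 g2 -> same_spans_from n' g2 g3 -> same_spans_from n' g1 g3.
Proof.
by move=> nn' h12 h23 N n'N; rewrite h12 ?h23//; exact: leq_trans n'N.
Qed.

(** Stage [k.+1] keeps the first [k] vectors, so the diagonal family [fun i => G i.+1 i] serves as
    the limit of the stages. *)
Lemma stable_limit (G : nat -> nat -> H) :
  (forall k i, (i < k)%N -> G k.+1 i = G k i) ->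
  forall k i, (i < k)%N -> G k i = G i.+1 i.
Proof.
move=> st k i; elim: k => // k IH; rewrite ltnS leq_eqVlt => /orP[/eqP -> //|ik].
by rewrite st// IH.
Qed.

End FiniteSpan.

(** * Inner products, closures and diagonals of a symmetric operator *)

Section Operator.
Variables (R : realType) (H : lmodType R[i]) (ip : H -> H -> R[i]).
Variables (D : set H) (E : H -> H).
Hypotheses (ipP : is_inner_product ip) (Dsub : hsubspace D).
Hypotheses (Elin : hlinear_on D E) (Esym : hsymmetric_on ip D E).
Implicit Types (g e : nat -> H) (x y u v : H) (a b : nat -> R).

Let ipC x y : ip y x = conjc (ip x y). Proof. by case: ipP. Qed.

Let ip0l x : ip 0 x = 0.
Proof.
case: ipP => lin _ _ _; have := lin (-1) 0 0 x.
by rewrite scaler0 addr0 mulN1r addNr.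
Qed.

Let ipDl x y u : ip (x + y) u = ip x u + ip y u.
Proof.
by case: ipP => lin _ _ _; have := lin 1 x y u; rewrite scale1r mul1r.
Qed.

Let ipZl (c : R[i]) x u : ip (c *: x) u = c * ip x u.
Proof.
by case: ipP => lin _ _ _; have := lin c x 0 u; rewrite addr0 ip0l addr0.
Qed.

Let ipDr x y u : ip u (x + y) = ip u x + ip u y.
Proof. by rewrite ipC ipDl conjcD -!ipC. Qed.

Let ipZr (c : R[i]) x u : ip u (c *: x) = conjc c * ip u x.
Proof. by rewrite ipC ipZl conjcM -ipC. Qed.

Let ipE := (ipDl, ipDr, ipZl, ipZr).

Let Dcomb (c c' : R[i]) x y : D x -> D y -> D (c *: x + c' *: y).
Proof.
case: Dsub => [D0 Dl] Dx Dy; apply: (Dl) => //.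
by rewrite -[_ *: _]addr0; exact: Dl.
Qed.

Let Ecomb (c c' : R[i]) x y : D x -> D y ->
  E (c *: x + c' *: y) = c *: E x + c' *: E y.
Proof.
case: Dsub => [D0 Dl] Dx Dy.
have E0 : E 0 = 0.
  by have := Elin (-1) D0 D0; rewrite scaler0 addr0 scaleN1r addNr.
have EZ : E (c' *: y) = c' *: E y.
  by have := Elin c' Dy D0; rewrite E0 !addr0.
rewrite Elin ?EZ//.
by rewrite -[_ *: _]addr0; exact: Dl.
Qed.

Lemma nrm2_parallelogram x y :
  nrm2 ip (x + y) + nrm2 ip (x - y) = 2 * nrm2 ip x + 2 * nrm2 ip y.
Proof.
rewrite /nrm2 -scaleN1r !ipE !conjcN !conjc1.
move: (ip x x) (ip y y) (ip x y) (ip y x) => [p ?] [q ?] [r ?] [s ?] /=; ring.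
Qed.

Lemma nrm2_ge0 x : 0 <= nrm2 ip x.
Proof.
by case: ipP => _ _ pos _; have := pos x; rewrite lecE /= => /andP[].
Qed.

(** A triangle inequality for squared norms, with constant 2, read off the parallelogram law; it is
    enough for closure arguments. *)
Lemma nrm2_le x y : nrm2 ip (x + y) <= 2 * nrm2 ip x + 2 * nrm2 ip y.
Proof. by rewrite -nrm2_parallelogram lerDl nrm2_ge0. Qed.

Lemma hclosure_sub (A B : set H) : (A `<=` hclosure ip B)%classic ->
  (hclosure ip A `<=` hclosure ip B)%classic.
Proof.
move=> AB x xA eps eps0; have h0 : 0 < eps / 2 by rewrite divr_gt0.
have [y [Ay xy]] := xA _ h0; have [z [Bz yz]] := AB _ Ay _ h0.
exists z; split=> //; have := nrm2_le (x - y) (y - z).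
rewrite addrA subrK => /le_lt_trans; apply.
rewrite (_ : eps ^+ 2 = 2 * (eps / 2) ^+ 2 + 2 * (eps / 2) ^+ 2); last by field.
lra.
Qed.

Lemma subset_hclosure (A : set H) : (A `<=` hclosure ip A)%classic.
Proof.
move=> x Ax eps eps0; exists x; split=> //.
by rewrite subrr /nrm2 ip0l /= exprn_gt0.
Qed.

Definition has_diagonal g a : Prop :=
  [/\ horthonormal ip g, forall i, D (g i) &
      forall i, ip (E (g i)) (g i) = (a i)%:C].

Lemma eq_has_diagonal g a b : a =1 b -> has_diagonal g a -> has_diagonal g b.
Proof. by move=> ab [o Dg v]; split=> // i; rewrite -ab. Qed.

(* The phase of the rotation is chosen so that the off-diagonal entry does not
   contribute; diagonal entries then move along the segment [a i, a j]. *)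
Lemma rotate_pair g a (i j : nat) (c : R) :
  has_diagonal g a -> i != j -> a i <= c <= a j ->
  exists (g' : nat -> H) (p q : R[i]) (s : R),
    [/\ has_diagonal g' (fun k => if k == i then c else
                                  if k == j then a i + a j - c else a k),
        forall k, k != i -> k != j -> g' k = g k,
        (forall N, (i < N)%N -> (j < N)%N -> fspan N g = fspan N g'),
        g i = p *: g' i + q *: g' j &
        [/\ 0 <= s, s <= 1, s * (a j - a i) = c - a i & q * conjc q = s%:C]].
Proof.
move=> [og Dg vg] ij acb; have ji : j != i by rewrite eq_sym.
have [p [s [q [s0 ps sE qs qz]]]] := rotation_coef (ip (E (g i)) (g j)) acb.
have Eji : ip (E (g j)) (g i) = conjc (ip (E (g i)) (g j)).
  by rewrite Esym// ipC.
have s1 : s <= 1 by have := sqr_ge0 p; lra.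
have psC : p%:C * p%:C + q * conjc q = 1.
  by rewrite qs -real_complexM -real_complexD -expr2 ps.
(* The matrix with rows [p, q] and [- conjc q, p] is unitary; [gi] and [gj] below apply its adjoint,
   whence the coefficient [- q] returned. *)
pose e := p%:C *: g i + q *: g j.
pose r := (- conjc q) *: g i + p%:C *: g j.
pose g' k := if k == i then e else if k == j then r else g k.
have g'i : g' i = e by rewrite /g' eqxx.
have g'j : g' j = r by rewrite /g' (negbTE ji) eqxx.
have gi : g i = p%:C *: e + (- q) *: r.
  rewrite /e /r !scalerDr !scalerA addrACA -!scalerDl.
  rewrite (_ : p%:C * q + _ = 0); last by ring.
  rewrite scale0r addr0 (_ : _ + _ = 1) ?scale1r//.
  by rewrite -[RHS]psC; ring.
have gj : g j = conjc q *: e + p%:C *: r.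
  rewrite /e /r !scalerDr !scalerA addrACA -!scalerDl.
  rewrite (_ : conjc q * p%:C + _ = 0); last by ring.
  rewrite scale0r add0r (_ : _ + _ = 1) ?scale1r//.
  by rewrite -[RHS]psC; ring.
have ee : ip e e = 1.
  by rewrite /e !ipE !og !eqxx (negbTE ij) (negbTE ji) !(mulr1n, mulr0n) conjc_real -[RHS]psC; ring.
have rr : ip r r = 1.
  rewrite /r !ipE !og !eqxx (negbTE ij) (negbTE ji) !(mulr1n, mulr0n) conjc_real conjcN conjcK.
  by rewrite -[RHS]psC; ring.
have er : ip e r = 0.
  rewrite /e /r !ipE !og !eqxx (negbTE ij) (negbTE ji) !(mulr1n, mulr0n) conjc_real conjcN conjcK.
  ring.
have ek k : k != i -> k != j -> ip e (g k) = 0.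
  move=> ki kj; rewrite /e !ipE !og ![_ == k]eq_sym (negbTE ki) (negbTE kj).
  by rewrite !mulr0 addr0.
have rk k : k != i -> k != j -> ip r (g k) = 0.
  move=> ki kj; rewrite /r !ipE !og ![_ == k]eq_sym (negbTE ki) (negbTE kj).
  by rewrite !mulr0 addr0.
exists g', p%:C, (- q), s; split.
- split.
  + move=> k l; rewrite /g'.
    have [ki|ki] := eqVneq k i; have [li|li] := eqVneq l i.
    * by rewrite ki li eqxx ee.
    * rewrite ki [i == l]eq_sym (negbTE li).
      by have [_|lj] := eqVneq l j; rewrite ?er ?ek.
    * rewrite li (negbTE ki) ipC.
      by have [_|kj] := eqVneq k j; rewrite ?er ?ek// conjc0.
    have [kj|kj] := eqVneq k j; have [lj|lj] := eqVneq l j.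
    * by rewrite kj lj eqxx rr.
    * by rewrite kj [j == l]eq_sym (negbTE lj) rk.
    * by rewrite lj (negbTE kj) ipC rk// conjc0.
    * exact: og.
  + by move=> k; rewrite /g'; case: ifP => _; [|case: ifP => _]; rewrite ?Dg//;
      apply: Dcomb; exact: Dg.
  + move=> k; rewrite /g'; case: ifP => _; [|case: ifP => _]; last exact: vg.
    * rewrite /e Ecomb// !ipE !vg Eji conjc_real.
      set z := ip _ _ in qz *.
      (* The cross terms collect into [p] times the expression made zero by the choice of phase. *)
      rewrite (_ : _ + _ = p%:C * p%:C * (a i)%:C + q * conjc q * (a j)%:C +
        p%:C * (conjc q * z + q * conjc z)); last by ring.
      rewrite qz mulr0 addr0 qs -!real_complexM -real_complexD; congr _%:C.
      by rewrite -expr2 (_ : p ^+ 2 = 1 - s); lra.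
    * rewrite /r Ecomb// !ipE !vg Eji conjc_real conjcN conjcK.
      set z := ip _ _ in qz *.
      rewrite (_ : _ + _ = q * conjc q * (a i)%:C + p%:C * p%:C * (a j)%:C -
        p%:C * (conjc q * z + q * conjc z)); last by ring.
      rewrite qz mulr0 subr0 qs -!real_complexM -real_complexD; congr _%:C.
      by rewrite -expr2 (_ : p ^+ 2 = 1 - s); lra.
- by move=> k /negbTE ki /negbTE kj; rewrite /g' ki kj.
- move=> N iN jN; apply/seteqP; split; apply: fspan_sub => k kN.
  + have [->|ki] := eqVneq k i.
      by rewrite gi -g'i -g'j; apply: fspan_comb2; exact: fspan_gen.
    have [->|kj] := eqVneq k j.
      by rewrite gj -g'i -g'j; apply: fspan_comb2; exact: fspan_gen.
    rewrite (_ : g k = g' k); first exact: fspan_gen.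
    by rewrite /g' (negbTE ki) (negbTE kj).
  + rewrite /g'; case: ifP => _; [|case: ifP => _]; last exact: fspan_gen;
      by apply: fspan_comb2; exact: fspan_gen.
- by rewrite g'i g'j.
- by split=> //; rewrite conjcN mulrNN.
Qed.

(* Greedy induction: the first entry [a m <= b m] is rotated against the first
   later entry that is at least [b m]; sortedness of [b] keeps the remaining
   partial sums nonnegative. *)
Lemma block_schur_horn (n m : nat) g a b :
  has_diagonal g a ->
  (forall k, (m <= k <= m + n)%N -> 0 <= \sum_(m <= i < k) (b i - a i)) ->
  \sum_(m <= i < m + n) (b i - a i) = 0 ->
  (forall i, (m <= i)%N -> (i.+1 < m + n)%N -> b i <= b i.+1) ->
  exists g', [/\ has_diagonal g' (fun i => if (m <= i < m + n)%N then b i else a i),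
    forall i, (i < m)%N -> g' i = g i & same_spans_from (m + n) g g'].
Proof.
elim: n m g a => [|n IH] m g a ga sum_ge0 sum0 bnd.
  exists g; split=> //; apply: eq_has_diagonal ga => i.
  by rewrite (_ : (m <= i < m + 0)%N = false)//; lia.
have bm i : (m <= i < m + n.+1)%N -> b m <= b i.
  elim: i => [|i IHi] mi; first by rewrite (_ : m = 0)%N//; lia.
  have [->//|im] := eqVneq i.+1 m.
  by rewrite (le_trans (IHi _))// ?bnd//; lia.
have abm : a m <= b m.
  have := sum_ge0 m.+1; rewrite big_nat1 subr_ge0; apply; lia.
(* If every [a j] in the block were below [b m <= b j], the total over the block would be
   positive. *)
have ex : exists j, [&& (m <= j)%N, (j < m + n.+1)%N & b m <= a j].
  apply: contrapT => nex; have aj j : (m <= j < m + n.+1)%N -> a j < b j.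
    move=> mj; apply: lt_le_trans (bm _ mj); rewrite ltNge; apply/negP => h.
    by apply: nex; exists j; rewrite h andbT.
  move/eqP: sum0; rewrite big_ltn; last lia.
  rewrite gt_eqF// ltr_pwDl ?subr_gt0 ?aj//; first lia.
  rewrite big_nat_cond sumr_ge0// => j; rewrite andbT subr_ge0 => mj.
  by rewrite ltW// aj//; lia.
case: (ex_minnP ex) => j /and3P[mj jn bmaj] jmin.
have jlt i : (m <= i < j)%N -> a i < b m.
  move=> mi; rewrite ltNge; apply/negP => h.
  by have := jmin i; rewrite h andbT => k; lia.
have ambm : j = m -> a m = b m by move=> jm; apply/eqP; rewrite eq_le abm -{2}jm.
(* If [j = m] then [a m = b m] and nothing is rotated; the formula for [a1] covers both cases. *)
have [g1 [a1 [ga1 g1m sp1 [a1m a1E]]]] : exists g1 a1,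
    [/\ has_diagonal g1 a1, forall i, (i < m)%N -> g1 i = g i,
        same_spans_from (m + n.+1) g g1 &
        a1 m = b m /\ forall i, i != m ->
          a1 i = a i + (if i == j then a m - b m else 0)].
  have [jm|jm] := eqVneq j m.
    exists g, a; split=> //; split=> [|i im]; first exact: ambm.
    by case: ifP => _; rewrite ?ambm// ?subrr addr0.
  have mj' : m != j by rewrite eq_sym.
  have acb : a m <= b m <= a j by rewrite abm bmaj.
  have [g1 [p [q [s [ga1 g1E sp _ _]]]]] := rotate_pair ga mj' acb.
  eexists; eexists; split; first exact: ga1.
  - by move=> i im; apply: g1E; lia.
  - by move=> N mN; apply: sp; lia.
  - rewrite /= eqxx; split=> // i /negbTE im; rewrite im.
    by case: eqP => [->|_]; ring.
have sumE k : (m < k)%N -> \sum_(m.+1 <= i < k) (b i - a1 i) =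
    \sum_(m <= i < k) (b i - a i) - (b m - a m) +
    (if (m.+1 <= j < k)%N then b m - a m else 0).
  move=> mk; rewrite [in RHS]big_ltn// [b m - a m + _]addrC addrK.
  have -> : (if (m.+1 <= j < k)%N then b m - a m else 0) =
      \sum_(m.+1 <= i < k | i == j) (b m - a m) by rewrite big_nat1_eq.
  rewrite [X in _ = _ + X]big_mkcond -big_split /=.
  apply: eq_big_nat => i mi; rewrite a1E; last lia.
  by case: ifP => _; ring.
have [|||g' [g'a g'm sp']] := IH m.+1 g1 a1 ga1.
(* Sums stopping before [j] is included have nonnegative terms, as [a i < b m <= b i]; once [j] is
   included it has absorbed [b m - a m] and the old partial sum returns. *)
- move=> k mk; rewrite sumE; last lia.
  case: ifP => jk; first by rewrite subrK sum_ge0//; lia.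
  rewrite addr0; have [jm|jm] := eqVneq j m.
    by rewrite ambm// subrr subr0 sum_ge0//; lia.
  rewrite big_ltn; last lia.
  rewrite addrC addKr big_nat_cond sumr_ge0// => i; rewrite andbT subr_ge0 => mi.
  by rewrite ltW// (lt_le_trans (jlt i _) (bm i _))//; lia.
- rewrite sumE; last lia.
  rewrite addSn -addnS sum0; case: ifP => jk; first by rewrite sub0r addNr.
  by rewrite ambm ?subrr ?subr0 ?addr0//; lia.
- by move=> i mi im; apply: bnd; lia.
exists g'; split.
- apply: eq_has_diagonal g'a => i; case: ifP => mi.
    by rewrite ifT//; lia.
  have [->|im] := eqVneq i m; first by rewrite a1m ifT//; lia.
  rewrite ifF; last lia.
  by rewrite a1E//; case: eqP => [ij|_]; [lia | rewrite addr0].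
- by move=> i im; rewrite g'm ?g1m//; lia.
- by rewrite addnS -addSn; apply: (same_spans_trans (leqnn _) _ sp'); rewrite addSn -addnS.
Qed.

(** The zeros of [psum mu l] cut the indices into finite blocks. Each block is solved separately and
    leaves the earlier vectors alone, so the stages stabilise; the last hypothesis makes [mu] sorted
    inside a block. *)
Lemma recurrent_schur_horn f l mu :
  has_diagonal f l -> (forall k, 0 <= psum mu l k) ->
  (forall N, exists k, (N <= k)%N /\ psum mu l k = 0) ->
  (forall i, 0 < psum mu l i.+1 -> mu i <= mu i.+1) ->
  exists g, has_diagonal g mu /\ aspan g = aspan f.
Proof.
move=> fl ps0 io mund.
pose P k (x : (nat -> H) * nat) := [/\ (k <= x.2)%N, psum mu l x.2 = 0,
  has_diagonal x.1 (fun i => if (i < x.2)%N then mu i else l i) &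
  same_spans_from x.2 f x.1].
pose Q (k : nat) (x y : (nat -> H) * nat) :=
  (x.2 < y.2)%N /\ forall i, (i < x.2)%N -> y.1 i = x.1 i.
have P0 : P 0%N (f, 0%N) by split=> //=; rewrite /psum big_ord0.
have psumB m k : (m <= k)%N ->
    \sum_(m <= i < k) (mu i - l i) = psum mu l k - psum mu l m.
  move=> mk; rewrite /psum -!(big_mkord xpredT (fun i => mu i - l i)).
  by rewrite [X in _ = X - _](big_cat_nat (leq0n m) mk) /= [RHS]addrAC subrr add0r.
have step k (x : (nat -> H) * nat) : P k x -> exists w, P k.+1 w /\ Q k x w.
  case: x => g n [/= kn pn gd sp].
  have ex : exists n', (n < n')%N && (psum mu l n' == 0).
    by have [n' [nn' pn']] := io n.+1; exists n'; rewrite nn' pn' eqxx.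
  (* The next zero is taken minimal, so that [psum mu l] is positive strictly inside the block. *)
  case: (ex_minnP ex) => n' /andP[nn' /eqP pn'] n'min.
  have nE : (n + (n' - n) = n')%N by lia.
  have sE j : (n <= j)%N ->
      \sum_(n <= i < j) (mu i - (if (i < n)%N then mu i else l i)) = psum mu l j.
    move=> nj; have := psumB _ _ nj; rewrite pn subr0 => <-.
    by apply: eq_big_nat => i /andP[ni _]; rewrite ltnNge ni.
  have [|||g' [g'd g'n sp']] := @block_schur_horn (n' - n) n g _ mu gd.
  - by move=> j nj; rewrite sE ?ps0//; lia.
  - by rewrite nE sE// ltnW.
  - move=> i ni; rewrite nE => in'; apply: mund; rewrite lt_neqAle ps0 andbT eq_sym.
    by apply/negP => pi; have := n'min i.+1; rewrite pi andbT => h; lia.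
  rewrite nE in g'd sp'.
  exists (g', n'); split; last by split.
  split=> //=; first lia.
    apply: eq_has_diagonal g'd => i.
    by have [i1|i1] := ltnP i n; have [i2|i2] := ltnP i n' => //=; lia.
  exact: same_spans_trans (ltnW nn') sp sp'.
have [s [_ sP sQ]] := dependent_choice_nat P0 step.
pose G k := (s k).1.
have Gst k i : (i < k)%N -> G k.+1 i = G k i.
  move=> ik; have [_ h] := sQ k; apply: h.
  by have [kn _ _ _] := sP k; exact: leq_trans ik kn.
have Glim := stable_limit Gst.
(* Stage [k] is final up to its cut [(s k).2], not merely up to [k]; the spans are compared at that
   cut. *)
have Gst2 k i : (i < (s k).2)%N -> G k i = G i.+1 i.
  have sinc t : G (k + t)%N i = G k i /\ ((s k).2 <= (s (k + t)%N).2)%N \/ ((s k).2 <= i)%N.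
    elim: t => [|t [[IH1 IH2]|IH]]; [by left; rewrite addn0 | | by right].
    have [?|ik] := leqP (s k).2 i; first by right.
    left; have [lt h] := sQ (k + t)%N; rewrite addnS; split; last lia.
    by rewrite -IH1; apply: h; lia.
  move=> ik; have [[<- _]|] := sinc i.+1; last lia.
  by rewrite Glim//; lia.
exists (fun i => G i.+1 i); split.
  split.
  - move=> i j; have [_ _ [o _ _] _] := sP (maxn i j).+1.
    by rewrite -(Glim (maxn i j).+1 i) -1?(Glim (maxn i j).+1 j)
      ?ltnS ?leq_maxl ?leq_maxr//; exact: o.
  - by move=> i; have [_ _ [_ Dg _] _] := sP i.+1; exact: Dg.
  - move=> i; have [ki _ [_ _ v] _] := sP i.+1.
    by have := v i; rewrite ki.
apply/seteqP; split=> [x [N xN]|x [N xN]].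
  exists (s N).2; have [Nn _ _ sp] := sP N.
  suff: fspan (s N).2 f x by [].
  rewrite sp//; apply: fspan_widen Nn _ _; have : fspan N (fun i => G i.+1 i) x by [].
  rewrite (@eq_fspan _ _ _ _ (G N))//.
  by move=> j jN; rewrite Glim.
exists (s N).2; have [Nn _ _ sp] := sP N.
suff: fspan (s N).2 (fun i => G i.+1 i) x by [].
rewrite (@eq_fspan _ _ _ _ (G N)); last first.
  by move=> j jN; rewrite Gst2.
by rewrite -sp//; apply: fspan_widen Nn _ _.
Qed.

(** Stage [k] rotates the left-over vector against the next one and fixes [e k]. Finite spans agree
    only with the left-over vector included, so the closure claim amounts to the residue of a fixed
    vector along it tending to 0. *)
Lemma carry_schur_horn g d mu (C : nat -> R) (B : R) :
  has_diagonal g mu -> nondecreasing_seq d -> unbounded_seq d ->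
  C 0%N = 0 -> (forall k, 0 <= C k <= B) ->
  (forall k, mu k = d k + C k - C k.+1) -> (forall k, d k <= mu k.+1) ->
  exists e, [/\ has_diagonal e d, forall i, aspan g (e i) &
                (aspan g `<=` cspan ip e)%classic].
Proof.
move=> gmu dnd dub C0 CB muE dmu.
pose P k (G : nat -> H) := has_diagonal G (fun i => if (i < k)%N then d i else
    if i == k then d k - C k.+1 else mu i) /\ same_spans_from k.+1 g G.
(* The equation for [s] avoids a quotient, whose denominator vanishes when [C k.+1 = 0] and
   [mu k.+1 = d k]. *)
pose Q k (G G' : nat -> H) := (forall i, (i < k)%N -> G' i = G i) /\
  exists (p q : R[i]) (s : R), G k = p *: G' k + q *: G' k.+1 /\
    [/\ 0 <= s, s <= 1, s * (mu k.+1 - d k + C k.+1) = C k.+1 & q * conjc q = s%:C].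
have P0 : P 0%N g.
  split=> //; apply: eq_has_diagonal gmu => i /=.
  by case: eqP => [->|_//]; rewrite muE C0 addr0.
have step k G : P k G -> exists G', P k.+1 G' /\ Q k G G'.
  move=> [Gd sp]; have kk : k != k.+1 by lia.
  have k1 : (k.+1 < k)%N = false by lia.
  have k2 : (k.+1 == k) = false by lia.
  have [|G' [p [q [s [G'd G'k sp' Gk [s0 s1 sE qs]]]]]] :=
      @rotate_pair _ _ k k.+1 (d k) Gd kk.
    by rewrite ltnn eqxx k1 k2 dmu andbT lerBlDr lerDl; case/andP: (CB k.+1).
  move: G'd sE; rewrite ltnn eqxx k1 k2 => G'd sE.
  exists G'; split; split.
  - apply: eq_has_diagonal G'd => i.
    have [->|ik] := eqVneq i k; first by rewrite ltnS leqnn.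
    have [->|ik1] := eqVneq i k.+1; first by rewrite ltnn muE; ring.
    by rewrite ltnS [(i <= k)%N]leq_eqVlt (negbTE ik).
  - apply: same_spans_trans (leqnSn _) sp _ => N kN; apply: sp'; lia.
  - by move=> i ik; apply: G'k; lia.
  - exists p, q, s; split=> //; split=> //.
    rewrite (_ : mu k.+1 - d k + C k.+1 = mu k.+1 - (d k - C k.+1)); last by ring.
    by rewrite sE subKr.
have [G [_ GP GQ]] := dependent_choice_nat P0 step.
have Gst k i : (i < k)%N -> G k.+1 i = G k i by move=> ik; have [h _] := GQ k; exact: h.
have Glim := stable_limit Gst.
pose e i := G i.+1 i.
have eE k : fspan k e = fspan k (G k).
  by apply: eq_fspan => j jk; rewrite Glim.
exists e; split.
- split.
  + move=> i j; have [[o _ _] _] := GP (maxn i j).+1.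
    by rewrite /e -(Glim (maxn i j).+1 i) -1?(Glim (maxn i j).+1 j)
      ?ltnS ?leq_maxl ?leq_maxr//; exact: o.
  + by move=> i; have [[_ Dg _] _] := GP i.+1; exact: Dg.
  + by move=> i; have [[_ _ v] _] := GP i.+1; have := v i; rewrite ltnSn.
- move=> i; have [_ sp] := GP i.+1; exists i.+2.
  by suff: fspan i.+2 g (e i) by []; rewrite sp//; apply: fspan_gen.
move=> x [N xN].
(* [W] telescopes the gaps [mu k.+1 - d k >= 0]; starting above [B], it dominates every carry, and
   it is unbounded because [d] is. *)
pose W t := B + 1 + (d (N + t)%N - d N + C N.+1 - C (N + t).+1).
have WS t : W t.+1 = W t + (mu (N + t).+1 - d (N + t)%N).
  by rewrite /W addnS muE; ring.
have WB t : B <= W t.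
  elim: t => [|t IH]; first by rewrite /W addn0; lra.
  by rewrite WS (le_trans IH)// lerDl subr_ge0.
(* Here [s] is the squared modulus of the component of [x] along the left-over vector; it decays at
   least like [1 / W t]. *)
have [s0 [s00 inv]] : exists s0, 0 <= s0 /\ forall t, exists (y : H) (c : R[i]) (s : R),
    [/\ aspan e y, x = y + c *: G (N + t)%N (N + t)%N, c * conjc c = s%:C, 0 <= s &
        s * W t <= s0 * W 0%N].
  (* The spans of [g] and [G N] agree only from [N.+1] on; index [N] carries the left-over
     vector. *)
  have [c xE] : fspan N.+1 (G N) x.
    by have [_ sp] := GP N; rewrite -sp//; apply: fspan_widen (leqnSn _) _ _.
  pose s0 := complex.Re (c N * conjc (c N)).
  have s0E : c N * conjc (c N) = s0%:C.
    rewrite /s0; case: (c N) => p q; apply/eqP; rewrite eq_complex /= eqxx /=.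
    by apply/eqP; ring.
  have s00 : 0 <= s0.
    by rewrite /s0; case: (c N) => p q /=; rewrite mulrN opprK addr_ge0// -expr2 sqr_ge0.
  exists s0; split=> //; elim=> [|t [y [c' [s [ey xy cs sge sW]]]]].
    exists (\sum_(j < N) c j *: G N j), (c N), s0; rewrite addn0; split=> //.
      by exists N, c; apply: eq_bigr => j _; rewrite /e -(Glim N).
    by rewrite xE big_ord_recr.
  have [_ [p [q [s' [Gk [s'0 s'1 s'E qs]]]]]] := GQ (N + t)%N.
  set k := (N + t)%N in xy Gk s'E *.
  exists (y + (c' * p) *: e k), (c' * q), (s * s'); rewrite addnS; split.
  - have [n yn] := ey; exists (maxn n k.+1); rewrite addrC.
    apply: (@fspan_comb _ _ (maxn n k.+1) e); first by apply: fspan_gen; lia.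
    by apply: (@fspan_widen _ _ n) yn; lia.
  - by rewrite xy Gk scalerDr !scalerA addrA.
  - by rewrite conjcM mulrACA cs qs real_complexM.
  - exact: mulr_ge0.
  - apply: le_trans sW; rewrite -mulrA; apply: ler_wpM2l => //.
    (* The aim is [s' * W t.+1 <= (W t - C k.+1) + C k.+1 = W t], using [s' <= 1] and
       [C k.+1 <= W t]. *)
    have W1 : (W t - C k.+1) * s' <= W t - C k.+1.
      rewrite ler_piMr// subr_ge0 (le_trans _ (WB t))//.
      by case/andP: (CB k.+1).
    rewrite WS -/k (_ : s' * _ = (W t - C k.+1) * s' +
      s' * (mu k.+1 - d k + C k.+1)); last by ring.
    by rewrite s'E -lerBrDr.
(* The term [d N] offsets the one in [W], so that [W m] exceeds [s0 * W 0 / eps ^+ 2] and the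
   residue falls below [eps ^+ 2]. *)
move=> eps eps0; have [m mP] := dub (s0 * W 0%N / eps ^+ 2 + d N).
have [y [c [s [ey xy cs sge sW]]]] := inv m.
exists y; split=> //.
have -> : nrm2 ip (x - y) = s.
  have [[o _ _] _] := GP (N + m)%N.
  by rewrite xy [y + _]addrC addrK /nrm2 !ipE o eqxx mulr1 cs.
have Wm : s0 * W 0%N / eps ^+ 2 < W m.
  have dm : d m <= d (N + m)%N by apply: dnd; exact: leq_addl.
  have /andP[C1 _] := CB N.+1; have /andP[_ C2] := CB (N + m).+1.
  by rewrite {2}/W; move: (s0 * _ / _) mP => X mP; lra.
have Wm0 : 0 < W m.
  apply: le_lt_trans Wm; rewrite divr_ge0 ?mulr_ge0 ?exprn_ge0// ?(ltW eps0)//.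
  by rewrite (le_trans _ (WB 0%N))//; case/andP: (CB 0%N); exact: le_trans.
move: Wm; rewrite ltr_pdivrMr ?exprn_gt0// => Wm.
by rewrite -(ltr_pM2r Wm0) (le_lt_trans sW) ?[_ * W m]mulrC.
Qed.

End Operator.

(** * Passage from [l] through the intermediate diagonal to [d] *)

Theorem theorem4p2 (R : realType) (H : lmodType R[i]) (ip : H -> H -> R[i])
    (D : set H) (E : H -> H) (d l : nat -> R) (f : nat -> H) :
  is_hilbert ip ->
  hsubspace D -> hdense ip D -> hlinear_on D E -> hsymmetric_on ip D E ->
  nondecreasing_seq d -> unbounded_seq d ->
  nondecreasing_seq l -> unbounded_seq l ->
  (forall k, 0 <= delta d l k) ->
  (exists M : nat, forall k : nat, (M <= k)%N ->
     (limn_einf (fun i => (delta d l i)%:E) <= (delta d l k)%:E)%E) ->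
  (forall i, D (f i)) -> horthonormal ip f ->
  (forall i, ip (E (f i)) (f i) = (l i)%:C) ->
  exists e : nat -> H,
    [/\ horthonormal ip e,
        (forall i, aspan f (e i)),
        cspan ip e = cspan ip f &
        forall i, ip (E (e i)) (e i) = (d i)%:C].
Proof.
move=> [ipP _] Dsub _ Elin Esym dnd dub _ _ delta0 /liminf_recurrently_below[M rb].
move=> Df of_ fl.
have ps0 k : 0 <= psum d l k.
  by case: k => [|k]; [rewrite /psum big_ord0 | exact: delta0].
have rb' : exists M, recurrently_below (fun k => psum d l (M + k)).
  (* [psum] at [M.+1 + k] is [delta] at [M + k]. *)
  exists M.+1 => K N; have [k [Nk kK]] := rb K N.
  by exists k.
have [C [B [C0 CD CB Cio [dC Cnd]]]] := carry_exists dnd dub ps0 rb'.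
pose mu k := d k + C k - C k.+1.
(* By telescoping, these sums vanish exactly where the carry meets [psum d l]. *)
have psE k : psum mu l k = psum d l k - C k.
  elim: k => [|k IH]; first by rewrite /psum !big_ord0 C0 subrr.
  by move: IH; rewrite /psum !big_ord_recr /= => ->; rewrite /mu; ring.
have dmu k : d k <= mu k.+1 by exact: dC.
have [||||g [gd gf]] := @recurrent_schur_horn _ _ _ _ _ ipP Dsub Elin Esym f l mu.
- by split.
- by move=> k; rewrite psE subr_ge0; case/andP: (CD k).
- by move=> N; have [k [Nk Ck]] := Cio N; exists k; rewrite psE Ck subrr.
(* Where the carry at [k.+1] is below the partial sum it has not decreased from [k], so
   [mu k <= d k <= mu k.+1]. *)
- move=> k; rewrite psE subr_gt0 => /Cnd Ck; apply: le_trans (dmu k).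
  by rewrite /mu; lra.
have [|//||e [[oe De ve] eg ge]] :=
  @carry_schur_horn _ _ _ _ _ ipP Dsub Elin Esym g d mu C B gd dnd dub C0.
- by move=> k; rewrite CB andbT; case/andP: (CD k).
- exact: dmu.
exists e; split=> //; first by move=> i; rewrite -gf.
apply/seteqP; split; rewrite /cspan -gf; apply: (hclosure_sub ipP) => //.
move=> x ex; apply: (subset_hclosure ipP).
exact: aspan_sub ex.
Qed.
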